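(* Let $A$ be an integral domain. A direct sum $\bigoplus_{i\in I} M_i$ of torsion-free $A$-modules is a PS module if and only if each $M_i$ is a PS module.
   Context: All rings are commutative and unitary. For an integral domain $A$, a torsion-free $A$-module $M$ is a PS module (pre-Schreier module) if every equality $ax=by$ with $a,b\in A-\{0\}$ and $x,y\in M-\{0\}$ has a refinement, i.e. there exist $c,d,e\in A$ and $z\in M$ with $a=ce$, $b=cd$, $x=dz$, $y=ez$. *)

(* Defs.v *)
From HB Require Import structures.
From mathcomp Require Import all_boot all_algebra.
From mathcomp Require Import boolp classical_sets cardinality.

Set Implicit Arguments.
Unset Strict Implicit.
Unset Printing Implicit Defensive.

Import GRing.Theory.
Local Open Scope ring_scope.

(* The sort is a separate constant because the library already equips
   non-dependent function types with a module structure. *)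
Definition direct_product (A : pzRingType) (I : Type) (M : I -> lmodType A) :
  Type := forall i, M i.

Section DirectProduct.
Variables (A : pzRingType) (I : Type) (M : I -> lmodType A).
Local Notation P := (direct_product M).

HB.instance Definition _ := gen_eqMixin P.
HB.instance Definition _ := gen_choiceMixin P.

Let add (f g : P) : P := fun i => f i + g i.
Let opp (f : P) : P := fun i => - f i.
Let zero : P := fun i => 0.
Let scale (a : A) (f : P) : P := fun i => a *: f i.

Fact direct_product_addA : associative add.
Proof. by move=> f g h; apply: functional_extensionality_dep => i; apply: addrA. Qed.

Fact direct_product_addC : commutative add.
Proof. by move=> f g; apply: functional_extensionality_dep => i; apply: addrC. Qed.

Fact direct_product_add0 : left_id zero add.
Proof. by move=> f; apply: functional_extensionality_dep => i; apply: add0r. Qed.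

Fact direct_product_addN : left_inverse zero opp add.
Proof. by move=> f; apply: functional_extensionality_dep => i; apply: addNr. Qed.

HB.instance Definition _ := GRing.isZmodule.Build P
  direct_product_addA direct_product_addC direct_product_add0
  direct_product_addN.

Fact direct_product_scaleA a b f : scale a (scale b f) = scale (a * b) f.
Proof. by apply: functional_extensionality_dep => i; apply: scalerA. Qed.

Fact direct_product_scale1 : left_id 1 scale.
Proof. by move=> f; apply: functional_extensionality_dep => i; apply: scale1r. Qed.

Fact direct_product_scaleDr : right_distributive scale +%R.
Proof. by move=> a f g; apply: functional_extensionality_dep => i; apply: scalerDr. Qed.

Fact direct_product_scaleDl f : {morph scale^~ f : a b / a + b}.
Proof. by move=> a b; apply: functional_extensionality_dep => i; apply: scalerDl. Qed.

HB.instance Definition _ := GRing.Zmodule_isLmodule.Build A P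
  direct_product_scaleA direct_product_scale1 direct_product_scaleDr
  direct_product_scaleDl.

Definition finite_support : {pred P} :=
  fun f => `[< finite_set [set i | f i != 0]%classic >].

Fact finite_support_submod_closed : submod_closed finite_support.
Proof.
split=> [|a f g /asboolP ff /asboolP fg]; apply/asboolP.
  by apply: (sub_finite_set _ (finite_set0 I)) => i /=; rewrite eqxx.
apply: (sub_finite_set _ (_ : finite_set ([set i | f i != 0] `|`
  [set i | g i != 0])%classic)); last by rewrite finite_setU.
move=> i /=; have [fi0|fi0] := eqVneq (f i) 0; last by left.
have -> : (a *: f + g) i = a *: f i + g i by [].
by rewrite fi0 scaler0 add0r; right.
Qed.

HB.instance Definition _ := GRing.isSubmodClosed.Build A P finite_support
  finite_support_submod_closed.

Record direct_sum := DirectSum {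
  component : P;
  _ : component \in finite_support
}.

HB.instance Definition _ := [isSub for component].
HB.instance Definition _ := [Choice of direct_sum by <:].
HB.instance Definition _ := [SubChoice_isSubLmodule of direct_sum by <:].

End DirectProduct.

Definition torsion_free (A : idomainType) (M : lmodType A) : Prop :=
  forall (a : A) (x : M), a *: x = 0 -> a = 0 \/ x = 0.

Definition PS_module (A : idomainType) (M : lmodType A) : Prop :=
  torsion_free M /\
  forall (a b : A) (x y : M), a != 0 -> b != 0 -> x != 0 -> y != 0 ->
    a *: x = b *: y ->
    exists (c d e : A) (z : M),
      [/\ a = c * e, b = c * d, x = d *: z & y = e *: z].

(* Main.v *)
(** For the direct sum, the factorization [a = c * e], [b = c * d] has to be the
    same for all components.  If it already serves the components in a finite
    set of indices, cancelling [c] in [a x_i = b y_i] gives [e x_i = d y_i] for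
    a further index [i]; refining this equality in [M i] moves a common factor
    [c'] of [d] and [e] into [c], and the old components absorb [c'] into their
    [z].  Conversely, a refinement in the direct sum projects to each
    component. *)
Require Import Defs.
From mathcomp Require Import all_boot all_algebra.
From mathcomp Require Import boolp classical_sets cardinality.

Set Implicit Arguments.
Unset Strict Implicit.
Unset Printing Implicit Defensive.

Import GRing.Theory.
Local Open Scope ring_scope.

Section Refinement.
Variable A : idomainType.

Lemma torsion_free_scaler_eq0 (M : lmodType A) (a : A) (x : M) :
  torsion_free M -> a != 0 -> a *: x = 0 -> x = 0.
Proof. by move=> tfM a0 /tfM[ae0|//]; rewrite ae0 eqxx in a0. Qed.

Lemma torsion_free_scalerI (M : lmodType A) (a : A) :
  torsion_free M -> a != 0 -> injective (GRing.scale a : M -> M).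
Proof.
move=> tfM a0 x y axy; apply/eqP; rewrite -subr_eq0; apply/eqP.
by apply: (torsion_free_scaler_eq0 tfM a0); rewrite scalerBr axy subrr.
Qed.

(** Torsion-freeness makes [x] and [y] vanish together, and zero elements have a trivial refinement.
    This case is needed because nonzero elements of a direct sum may have zero components. *)
Lemma PS_module_refine (M : lmodType A) (a b : A) (x y : M) :
  PS_module M -> a != 0 -> b != 0 -> a *: x = b *: y ->
  exists (c d e : A) (z : M),
    [/\ a = c * e, b = c * d, x = d *: z & y = e *: z].
Proof.
move=> [tfM psM] a0 b0 axby.
have [x0|x0] := eqVneq x 0.
  have y0 : y = 0.
    by apply: (torsion_free_scaler_eq0 tfM b0); rewrite -axby x0 scaler0.
  by exists 1, b, a, 0; rewrite !mul1r !scaler0.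
have [y0|y0] := eqVneq y 0; last exact: psM.
case/eqP: x0; apply: (torsion_free_scaler_eq0 tfM a0).
by rewrite axby y0 scaler0.
Qed.

Lemma PS_module_refine_seq (I : eqType) (M : I -> lmodType A) (a b : A)
    (x y : forall i, M i) (s : seq I) :
    (forall i, PS_module (M i)) -> a != 0 -> b != 0 ->
    (forall i, a *: x i = b *: y i) ->
  exists c d e : A, [/\ a = c * e, b = c * d &
    forall i, i \in s -> exists z : M i, x i = d *: z /\ y i = e *: z].
Proof.
move=> psM a0 b0 axby.
elim: s => [|i s [c [d [e [ace bcd IHs]]]]].
  (* With no index to serve, the factorization with [c = 1] starts the induction. *)
  by exists 1, b, a; split; rewrite ?mul1r.
move: (a0) (b0); rewrite {1}ace {1}bcd !mulf_eq0 !negb_or.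
move=> /andP[c0 e0] /andP[_ d0].
have exdy : e *: x i = d *: y i.
  apply: (torsion_free_scalerI (psM i).1 c0).
  by rewrite !scalerA -ace -bcd axby.
have [c' [d' [e' [z [ee dd xz yz]]]]] := PS_module_refine (psM i) e0 d0 exdy.
exists (c * c'), d', e'; split; rewrite -?mulrA -?ee -?dd // => j.
rewrite inE => /predU1P[->|/IHs[w [xw yw]]]; first by exists z.
by exists (c' *: w); rewrite !scalerA ![_ * c']mulrC -ee -dd.
Qed.

End Refinement.

Section DirectSum.
Variables (A : idomainType) (I : Type) (M : I -> lmodType A).

Lemma direct_sumP (f g : direct_sum M) :
  (forall i, component f i = component g i) -> f = g.
Proof. by move=> fg; apply/val_inj/functional_extensionality_dep. Qed.

Lemma componentZ (a : A) (f : direct_sum M) (i : I) :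
  component (a *: f) i = a *: component f i.
Proof. by []. Qed.

Lemma exists_direct_sum (f : forall i, M i) :
  finite_set [set i | f i != 0]%classic ->
  exists g : direct_sum M, forall i, component g i = f i.
Proof.
move=> finf.
have fP : (f : direct_product M) \in @finite_support A I M by apply/asboolP.
by exists (DirectSum fP).
Qed.

Lemma exists_single (i : I) (x : M i) :
  exists f : direct_sum M, component f i = x /\
    forall j, j <> i -> component f j = 0.
Proof.
(* Passing to [{classic I}] equips the arbitrary index type with the decidable equality required by
   [dfwith]. *)
pose f : forall j : {classic I}, M j :=
  dfwith (fun j : {classic I} => 0 : M j) (x : M (i : {classic I})).
have f0 j : j <> i -> f j = 0.
  by move=> ji; apply: dfwith_out; apply/eqP => ij; apply: ji.
have [|g gf] := @exists_direct_sum f.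
  apply: (sub_finite_set _ (finite_set1 (i : {classic I}))) => j /= fj.
  by apply: contrapT => /f0 fj0; rewrite fj0 eqxx in fj.
exists g; split=> [|j /f0 fj0]; rewrite gf //; exact: dfwith_in.
Qed.

Lemma torsion_free_direct_sum :
  (forall i, torsion_free (M i)) -> torsion_free (direct_sum M).
Proof.
move=> tfM a f af0; have [->|a0] := eqVneq a 0; first by left.
right; apply: direct_sumP => i.
apply: (torsion_free_scaler_eq0 (tfM i) a0).
by rewrite -componentZ af0.
Qed.

Lemma PS_module_direct_sum :
  (forall i, PS_module (M i)) -> PS_module (direct_sum M).
Proof.
move=> psM; split=> [|a b x y a0 b0 _ _ axby].
  by apply: torsion_free_direct_sum => i; have [] := psM i.
have axbyi i : a *: component x i = b *: component y i.
  by rewrite -!componentZ axby.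
have /asboolP finx : component x \in @finite_support A I M by case: x {axby axbyi}.
have [s sE] : exists s : seq {classic I},
    [set i | component x i != 0]%classic = [set` s]%classic.
  exact/(@finite_seqP {classic I}).
have [c [d [e [ace bcd zs]]]] :=
  @PS_module_refine_seq A {classic I} M a b _ _ s psM a0 b0 axbyi.
have d0 : d != 0 by apply: contra_neq b0 => de0; rewrite bcd de0 mulr0.
have exz i : exists z : M i, component x i = d *: z /\ component y i = e *: z.
  (* The sequence [s] lists only the support of [x]. Outside it [y] vanishes too, since [b] is
     nonzero, so [z = 0] serves with the same [d] and [e]. *)
  have [xi0|xi0] := eqVneq (component x i) 0; last first.
    by apply: zs; have : [set` s]%classic i by rewrite -sE.
  exists 0; rewrite !scaler0; split=> //.
  apply: (torsion_free_scaler_eq0 (psM i).1 b0).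
  by rewrite -axbyi xi0 scaler0.
pose z i := projT1 (cid (exz i)).
have zP i : component x i = d *: z i /\ component y i = e *: z i.
  exact: projT2 (cid (exz i)).
have [|w wz] := @exists_direct_sum z.
  (* The chosen family [z] has finite support: as [d] is nonzero, [x i = d *: z i] forces [z i] to
     vanish wherever [x i] does. *)
  apply: (sub_finite_set _ finx) => i /=; apply: contra_neq => xi0.
  by apply: (torsion_free_scaler_eq0 (psM i).1 d0); rewrite -(zP i).1.
by exists c, d, e, w; split=> //; apply: direct_sumP => i;
  rewrite componentZ wz; have [] := zP i.
Qed.

Lemma PS_module_component (i : I) :
  torsion_free (M i) -> PS_module (direct_sum M) -> PS_module (M i).
Proof.
move=> tfMi [_ psM]; split=> // a b x y a0 b0 x0 y0 axby.
(* A choice of single-component elements embeds [M i] in the direct sum. Linearity of [inj] is never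
   stated: the equality to be refined is checked on components, both sides being zero away from
   [i]. *)
have [inj injP] := choice (@exists_single i).
have inj_neq0 u : u != 0 -> inj u != 0.
  by apply: contra_neq => iu0; rewrite -(injP u).1 iu0.
have [|||c [d [e [z [ace bcd xz yz]]]]] :=
  psM a b (inj x) (inj y) a0 b0; rewrite ?inj_neq0 //.
  apply: direct_sumP => j; rewrite !componentZ.
  have [->|ji] := pselect (j = i); first by rewrite !(injP _).1.
  by rewrite !(injP _).2 // !scaler0.
exists c, d, e, (component z i); split=> //.
  by rewrite -componentZ -xz (injP x).1.
by rewrite -componentZ -yz (injP y).1.
Qed.

End DirectSum.

Theorem theorem4p2 (A : idomainType) (I : Type) (M : I -> lmodType A)
    (tfM : forall i : I, torsion_free (M i)) :
  PS_module (direct_sum M) <-> (forall i : I, PS_module (M i)).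
Proof.
split=> [psM i|]; last exact: PS_module_direct_sum.
exact: PS_module_component.
Qed.
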